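(* Let $F$ be a field of characteristic different from $2$ and let $A$ be a Lie-solvable Novikov algebra over $F$. Then the Baer radical of $A$ is given by $$\mathcal{B}(A)=\{x\in A\mid x^n=0 \text{ for some integer } n>0\},$$ where $x^n$ denotes the left-normed power of $x$.
   Context: A Novikov algebra over a field $F$ is a (not necessarily associative or unital) $F$-algebra satisfying the identities $(x,y,z)=(y,x,z)$ and $(xy)z=(xz)y$, where $(x,y,z)=(xy)z-x(yz)$. Left-normed powers of an element: $x^1=x$, $x^n=x^{n-1}x$ for $n>1$. Ideals are two-sided. For an ideal $I$ of a Novikov algebra, $[I,I]$ denotes the linear span of all commutators $[a,b]=ab-ba$, $a,b\in I$; it is again an ideal of the algebra. Put $A^{(0)_L}=A$, $A^{(n+1)_L}=[A^{(n)_L},A^{(n)_L}]$. $A$ is Lie-solvable if $A^{(n)_L}=0$ for some $n\ge 0$. Baer radical: an ideal $I$ is trivial if $I^2=0$. Set $\mathcal{B}_0(A)=0$ and let $\mathcal{B}_1(A)$ be the sum of all trivial ideals of $A$. For a limit ordinal $\alpha$, $\mathcal{B}_\alpha(A)=\bigcup_{\beta<\alpha}\mathcal{B}_\beta(A)$; for a successor ordinal $\alpha$, $\mathcal{B}_\alpha(A)$ is the full preimage in $A$ of $\mathcal{B}_1(A/\mathcal{B}_{\alpha-1}(A))$ under the quotient map. The Baer radical is $\mathcal{B}(A)=\mathcal{B}_\delta(A)$ for an ordinal $\delta$ with $\delta>|A|$ (the chain has stabilized by then). *)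

(* Defs.v *)
From HB Require Import structures.
From mathcomp Require Import all_boot all_order all_algebra.
From mathcomp Require Import boolp classical_sets functions cardinality.
From mathcomp Require wochoice.

Set Implicit Arguments.
Unset Strict Implicit.
Unset Printing Implicit Defensive.

Import GRing.Theory.
Local Open Scope classical_set_scope.
Local Open Scope card_scope.
Local Open Scope ring_scope.

HB.mixin Record hasBilinearMul (F : fieldType) A of GRing.Lmodule F A := {
  namul : A -> A -> A;
  namulDl : left_distributive namul +%R;
  namulDr : right_distributive namul +%R;
  namulZl : forall (c : F) (x y : A), namul (c *: x) y = c *: namul x y;
  namulZr : forall (c : F) (x y : A), namul x (c *: y) = c *: namul x y
}.

(* Neither associativity nor a unit is assumed. *)
#[short(type="naAlgType")]
HB.structure Definition NAAlgebra (F : fieldType) :=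
  {A of hasBilinearMul F A & GRing.Lmodule F A}.

Reserved Notation "x ** y" (at level 40, left associativity).
Notation "x ** y" := (namul x y) : ring_scope.

Definition nassoc (F : fieldType) (A : naAlgType F) (x y z : A) : A :=
  (x ** y) ** z - x ** (y ** z).

HB.mixin Record isNovikov (F : fieldType) A of NAAlgebra F A := {
  left_symmetric : forall x y z : A, nassoc x y z = nassoc y x z;
  right_commutative_mul : forall x y z : A, (x ** y) ** z = (x ** z) ** y
}.

#[short(type="novikovType")]
HB.structure Definition Novikov (F : fieldType) :=
  {A of isNovikov F A & NAAlgebra F A}.

Section Algebra.
Context (F : fieldType) (A : naAlgType F).
Implicit Types (x y : A) (I S : set A).

(* [lpow x n] is x^n for n > 0; the value at n = 0 is meaningless. *)
Definition lpow x (n : nat) : A := iter n.-1 (fun y => y ** x) x.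

Definition lspan S : set A :=
  [set x | exists (n : nat) (c : 'I_n -> F) (v : 'I_n -> A),
     (forall i, S (v i)) /\ x = \sum_(i < n) c i *: v i].

Definition is_ideal I : Prop :=
  [/\ I 0,
      forall x y, I x -> I y -> I (x + y),
      forall (c : F) x, I x -> I (c *: x),
      forall x y, I x -> I (x ** y) &
      forall x y, I y -> I (x ** y)].

Definition lie_square I : set A :=
  lspan [set a ** b - b ** a | a in I & b in I].

Fixpoint lie_derived (n : nat) : set A :=
  if n is m.+1 then lie_square (lie_derived m) else [set: A].

Definition lie_solvable : Prop := exists n : nat, lie_derived n = [set 0].

Definition trivial_ideal I : Prop :=
  is_ideal I /\ lspan [set a ** b | a in I & b in I] = [set 0].

Definition baer1 : set A :=
  [set x | exists (n : nat) (I : 'I_n -> set A) (v : 'I_n -> A),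
     (forall i, trivial_ideal (I i) /\ I i (v i)) /\ x = \sum_(i < n) v i].

End Algebra.

Arguments lie_solvable {F} A.
Arguments baer1 {F} A.

Section Quotient.
Context (F : fieldType) (A : naAlgType F) (J : set A) (idJ : is_ideal J).
Local Open Scope quotient_scope.

Definition ideal_mem : A -> bool := fun x => `[< J x >].

Lemma ideal_memP x : reflect (J x) (x \in ideal_mem).
Proof. exact: asboolP. Qed.

Lemma ideal_mem_zmod_closed : zmod_closed ideal_mem.
Proof.
have [J0 JD JZ _ _] := idJ; split=> [|x y /ideal_memP Jx /ideal_memP Jy].
  exact/ideal_memP.
by apply/ideal_memP/JD => //; rewrite -scaleN1r; apply: JZ.
Qed.

Definition ideal_zmodClosed : zmodClosed A := HB.pack ideal_mem
  (GRing.isZmodClosed.Build A ideal_mem ideal_mem_zmod_closed).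

Definition quot_alg : Type := {ideal_quot ideal_zmodClosed}.
HB.instance Definition _ := GRing.Zmodule.on quot_alg.

Definition quot_pi (x : A) : quot_alg := \pi_{ideal_quot ideal_zmodClosed} x.

Lemma quot_piD x y : quot_pi (x + y) = quot_pi x + quot_pi y.
Proof. exact: (raddfD \pi_{ideal_quot ideal_zmodClosed}). Qed.

Lemma quot_piB x y : quot_pi (x - y) = quot_pi x - quot_pi y.
Proof. exact: (raddfB \pi_{ideal_quot ideal_zmodClosed}). Qed.

Lemma quot_pi_surj (u : quot_alg) : exists x, quot_pi x = u.
Proof. by exists (repr u); rewrite /quot_pi reprK. Qed.

Lemma quot_pi_eq x y : quot_pi x = quot_pi y <-> J (x - y).
Proof.
split=> [/eqP|Jxy]; first by rewrite -Quotient.idealrBE => /ideal_memP.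
by apply/eqP; rewrite -Quotient.idealrBE; apply/ideal_memP.
Qed.

Lemma quot_pi_ker x : quot_pi x = 0 <-> J x.
Proof.
have -> : 0 = quot_pi 0 by rewrite -[in RHS](subrr 0) quot_piB subrr.
by rewrite quot_pi_eq subr0.
Qed.

Definition quot_scale (c : F) (u : quot_alg) : quot_alg :=
  quot_pi (c *: repr u).

Definition quot_mul (u v : quot_alg) : quot_alg := quot_pi (repr u ** repr v).

Lemma repr_quot_pi x : J (repr (quot_pi x) - x).
Proof. by apply/quot_pi_eq; rewrite /quot_pi reprK. Qed.

Lemma quot_scaleE c x : quot_scale c (quot_pi x) = quot_pi (c *: x).
Proof.
apply/quot_pi_eq; rewrite -scalerBr; have [_ _ JZ _ _] := idJ.
exact/JZ/repr_quot_pi.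
Qed.

Lemma namulBl (x y z : A) : (x - y) ** z = x ** z - y ** z.
Proof. by rewrite namulDl -scaleN1r namulZl scaleN1r. Qed.

Lemma namulBr (x y z : A) : z ** (x - y) = z ** x - z ** y.
Proof. by rewrite namulDr -scaleN1r namulZr scaleN1r. Qed.

Lemma quot_mulE x y : quot_mul (quot_pi x) (quot_pi y) = quot_pi (x ** y).
Proof.
apply/quot_pi_eq; have [_ JD _ JMl JMr] := idJ.
set x' := repr _; set y' := repr _.
have -> : x' ** y' - x ** y = (x' - x) ** y' + x ** (y' - y).
  by rewrite namulBl namulBr addrA subrK.
by apply: JD; [apply: JMl | apply: JMr]; apply: repr_quot_pi.
Qed.

Lemma quot_scaleA a b u :
  quot_scale a (quot_scale b u) = quot_scale (a * b) u.
Proof. by have [x <-] := quot_pi_surj u; rewrite !quot_scaleE scalerA. Qed.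

Lemma quot_scale1 : left_id 1 quot_scale.
Proof.
by move=> u; have [x <-] := quot_pi_surj u; rewrite quot_scaleE scale1r.
Qed.

Lemma quot_scaleDr : right_distributive quot_scale +%R.
Proof.
move=> c u v; have [x <-] := quot_pi_surj u; have [y <-] := quot_pi_surj v.
by rewrite !quot_scaleE -!quot_piD quot_scaleE scalerDr.
Qed.

Lemma quot_scaleDl u : {morph quot_scale^~ u : a b / a + b}.
Proof.
by move=> a b; have [x <-] := quot_pi_surj u; rewrite !quot_scaleE scalerDl quot_piD.
Qed.

HB.instance Definition _ := GRing.Zmodule_isLmodule.Build F quot_alg
  quot_scaleA quot_scale1 quot_scaleDr quot_scaleDl.

Lemma quot_piZ c x : quot_pi (c *: x) = c *: quot_pi x.
Proof. by rewrite -quot_scaleE. Qed.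

Lemma quot_mulDl : left_distributive quot_mul +%R.
Proof.
move=> u v w; have [x <-] := quot_pi_surj u; have [y <-] := quot_pi_surj v.
have [z <-] := quot_pi_surj w.
by rewrite !quot_mulE -!quot_piD quot_mulE namulDl.
Qed.

Lemma quot_mulDr : right_distributive quot_mul +%R.
Proof.
move=> u v w; have [x <-] := quot_pi_surj u; have [y <-] := quot_pi_surj v.
have [z <-] := quot_pi_surj w.
by rewrite !quot_mulE -!quot_piD quot_mulE namulDr.
Qed.

Lemma quot_mulZl c (u v : quot_alg) : quot_mul (c *: u) v = c *: quot_mul u v.
Proof.
have [x <-] := quot_pi_surj u; have [y <-] := quot_pi_surj v.
by rewrite quot_mulE -!quot_piZ quot_mulE namulZl.
Qed.

Lemma quot_mulZr c (u v : quot_alg) : quot_mul u (c *: v) = c *: quot_mul u v.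
Proof.
have [x <-] := quot_pi_surj u; have [y <-] := quot_pi_surj v.
by rewrite quot_mulE -!quot_piZ quot_mulE namulZr.
Qed.

HB.instance Definition _ := hasBilinearMul.Build F quot_alg
  quot_mulDl quot_mulDr quot_mulZl quot_mulZr.

Lemma quot_piM x y : quot_pi (x ** y) = quot_pi x ** quot_pi y.
Proof. by rewrite -quot_mulE. Qed.

End Quotient.

(* The full preimage of baer1 (A / J) under A -> A / J.  It is empty if J is
   not an ideal, a case that does not arise below. *)
Definition baer_preimage (F : fieldType) (A : naAlgType F) (J : set A) : set A :=
  [set x | exists idJ : is_ideal J, baer1 (quot_alg idJ) (quot_pi idJ x)].

Lemma well_order_antisymmetric (W : Type) (R : rel W) :
  wochoice.well_order R -> antisymmetric R.
Proof.
elim/Peq: W R => W R woR x y.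
have woRT : wochoice.wo_chain R predT by move=> C _; apply: woR.
exact: (wochoice.wo_chain_antisymmetric woRT).
Qed.

(* Ordinals are represented by the elements of well-ordered types: w stands
   for the order type of its initial segment {v | v < w}. *)
Section Ordinals.
Context (W : Type) (R : rel W).
Implicit Types u v w : W.

Definition wlt u v : Prop := ~~ R v u.

Lemma wlt_wf : wochoice.well_order R -> well_founded wlt.
Proof.
move=> woR w; apply: contrapT => nAw.
have [|z [[/asboolP nAz minz] _]] := woR (fun v => `[< ~ Acc wlt v >]).
  by exists w; apply/asboolP.
apply: nAz; constructor=> v ltvz; apply: contrapT => nAv.
by move: ltvz; rewrite /wlt minz //; apply/asboolP.
Qed.

Definition wzero w : Prop := forall v, ~ wlt v w.

Definition wsucc v w : Prop := wlt v w /\ forall u, wlt u w -> ~ wlt v u.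

Definition wlimit w : Prop := ~ wzero w /\ forall v, ~ wsucc v w.

(* w > |T|, where |T| is the least ordinal equipotent to T. *)
Definition above_card (T : Type) w : Prop :=
  exists2 v, wlt v w & [set: T] #= [set u | wlt u v].

End Ordinals.

Section Baer.
Context (F : fieldType) (A : naAlgType F).
Context (W : Type) (R : rel W) (woR : wochoice.well_order R).

Definition baer_step (w : W) (B : forall v, wlt R v w -> set A) : set A :=
  [set x | [\/ wzero R w /\ x = 0,
               exists v (vw : wlt R v w), wsucc R v w /\ baer_preimage (B v vw) x |
               wlimit R w /\ exists v (vw : wlt R v w), B v vw x]].

Definition baer : W -> set A := Fix (wlt_wf woR) (fun=> set A) baer_step.

Lemma baerE w : baer w = baer_step (fun v (_ : wlt R v w) => baer v).
Proof.
apply: (Fix_eq _ (fun=> set A)) => {}w f g fg; congr baer_step.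
by apply: functional_extensionality_dep => v; apply: functional_extensionality_dep.
Qed.

Lemma baer_zero w : wzero R w -> baer w = [set 0].
Proof.
move=> w0; rewrite baerE; apply/seteqP; split=> x /=.
  by case=> [[]//|[v [/w0]]//|[[]]].
by move=> ->; constructor 1.
Qed.

Lemma baer_succ v w : wsucc R v w -> baer w = baer_preimage (baer v).
Proof.
move=> vw; have [ltvw maxv] := vw.
rewrite baerE; apply/seteqP; split=> x /=; last by constructor 2; exists v, ltvw.
case=> [[/(_ v)]//|[u [ltuw [[_ maxu] Bu]]]|[[_ /(_ v)]//]].
suff -> : v = u by [].
have Ruv : R u v by apply: contrapT => /negP; apply: maxv.
have Rvu : R v u by apply: contrapT => /negP; apply: maxu.
by apply: (well_order_antisymmetric woR); rewrite Ruv Rvu.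
Qed.

Lemma baer_limit w : wlimit R w -> baer w = \bigcup_(v in wlt R ^~ w) baer v.
Proof.
move=> lw; have [nz ns] := lw; rewrite baerE; apply/seteqP; split=> x /=.
  by case=> [[]//|[v [_ [/ns]]]//|[_ [v [ltvw Bx]]]]; exists v.
by case=> v ltvw Bx; constructor 3; split=> //; exists v, ltvw.
Qed.

End Baer.

Arguments baer {F} A {W R} woR w.

(* Ordinals above |T| exist: well-order T and add two elements on top. *)
Lemma exists_above_card (T : Type) :
  exists (W : Type) (R : rel W) (w : W),
    wochoice.well_order R /\ above_card R T w.
Proof.
elim/Peq: T => T; have [r wor] := wochoice.well_ordering_principle T.
pose R (a b : option (option T)) := match a, b with
  | _, None => true
  | None, _ => false
  | _, Some None => true
  | Some None, _ => false
  | Some (Some x), Some (Some y) => r x y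
  end.
exists (option (option T)), R, None; split; last first.
  exists (Some None) => //; rewrite card_eq_sym.
  rewrite (_ : [set u | _] = (Some \o Some) @` [set: T]); last first.
    apply/seteqP; split=> [[[x|]|]|_ [x _ <-]] //= _.
    by exists x.
  by apply: inj_card_eq => x y _ _ [].
apply: wochoice.antisymmetric_well_order => [a b|P [a Pa]].
  case: a b => [[x|]|] [[y|]|] //=.
  by move/(well_order_antisymmetric wor) => ->.
have [[x Px]|nP] := pselect (exists x, P (Some (Some x))).
  have [|z [[Pz minz] _]] := wor (fun x => P (Some (Some x))); first by exists x.
  by exists (Some (Some z)); split=> // -[[y|]|] //= Py; apply: minz.
have [PN|nPN] := boolP (P (Some None)).
  by exists (Some None); split=> // -[[y|]|] //= Py; case: nP; exists y.
exists a; split=> // b Pb; case: a b Pa Pb => [[x|]|] [[y|]|] //= Pa Pb.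
- by case: nP; exists x.
- by case: nP; exists y.
- by case: nP; exists y.
- by rewrite -[X in ~~ X]/(Some None \in P) Pb in nPN.
Qed.

(* Main.v *)
(* A trivial ideal contributes only nil elements: if I^2 = 0 and x^m, x^(m+1)
   lie in I, then a x^m = a x^(m+1) = 0 for a in I, and eliminating the
   associator (a, x, x) gives a R_x^(m+1) = 0, so x^(2m+1) = 0.  Hence every
   element of the Baer radical is nil, by transfinite induction.

   Conversely, if L is an ideal such that K = [L, L] is commutative, then
   (K K) K = 0, so K lies in B_2(A).  Descending along the derived series puts
   [A, A] into some B_k(A) with k finite.  Modulo B_k(A) the algebra is
   commutative and associative, and each further step of the Baer chain lowers
   by one the exponent n with x^n in it.  So every nil element lies in B_k(A)
   for some finite k.  This finiteness is essential: delta only exceeds the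
   ordinal |A|, and in general a chain of ideals may still grow beyond it. *)
Require Import Defs.
From mathcomp Require Import all_boot all_algebra.
From mathcomp Require Import boolp classical_sets cardinality.
From mathcomp Require wochoice.

Set Implicit Arguments.
Unset Strict Implicit.
Unset Printing Implicit Defensive.

Import GRing.Theory.
Local Open Scope classical_set_scope.
Local Open Scope card_scope.
Local Open Scope ring_scope.

(** * Ideals, linear spans, and the sum of all trivial ideals *)

Section Ideals.
Context {F : fieldType} {A : naAlgType F}.
Implicit Types (x y z : A) (I J K S : set A).

Lemma ideal0 {I} : is_ideal I -> I 0.
Proof. by case. Qed.

Lemma idealD {I} x y : is_ideal I -> I x -> I y -> I (x + y).
Proof. by case=> _ ID _ _ _; apply: ID. Qed.

Lemma idealZ {I} c x : is_ideal I -> I x -> I (c *: x).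
Proof. by case=> _ _ IZ _ _; apply: IZ. Qed.

Lemma idealN {I} x : is_ideal I -> I x -> I (- x).
Proof. by move=> idI Ix; rewrite -scaleN1r; apply: idealZ. Qed.

Lemma idealB {I} x y : is_ideal I -> I x -> I y -> I (x - y).
Proof. by move=> idI Ix Iy; apply: idealD => //; apply: idealN. Qed.

Lemma idealMl {I} x y : is_ideal I -> I x -> I (x ** y).
Proof. by case=> _ _ _ IM _; apply: IM. Qed.

Lemma idealMr {I} x y : is_ideal I -> I y -> I (x ** y).
Proof. by case=> _ _ _ _ IM; apply: IM. Qed.

Lemma ideal_subl {I} x y : is_ideal I -> I (x - y) -> I y -> I x.
Proof. by move=> idI Ixy Iy; rewrite -(subrK y x); apply: idealD. Qed.

Lemma namul0l z : 0 ** z = 0 :> A.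
Proof. by rewrite -[X in X ** _](subrr 0) namulBl subrr. Qed.

Lemma namul0r z : z ** 0 = 0 :> A.
Proof. by rewrite -[X in _ ** X](subrr 0) namulBr subrr. Qed.

Lemma ideal_zero : is_ideal [set 0 : A].
Proof.
split=> [|_ _ -> ->|c _ ->|_ y ->|x _ ->] //=.
- exact: addr0.
- exact: scaler0.
- exact: namul0l.
- exact: namul0r.
Qed.

Lemma ideal_full : is_ideal [set: A].
Proof. by split. Qed.

Definition ideal_add I K : set A := [set z | exists2 a, I a & K (z - a)].

Lemma ideal_add_ideal I K : is_ideal I -> is_ideal K -> is_ideal (ideal_add I K).
Proof.
move=> idI idK; split=> [|x y [a Ia Ka] [b Ib Kb]|c x [a Ia Ka]|x y [a Ia Ka]|x y [a Ia Ka]].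
- by exists 0; rewrite ?subrr; apply: ideal0.
- by exists (a + b); [apply: idealD | rewrite opprD addrACA; apply: idealD].
- by exists (c *: a); [apply: idealZ | rewrite -scalerBr; apply: idealZ].
- by exists (a ** y); [apply: idealMl | rewrite -namulBl; apply: idealMl].
- by exists (x ** a); [apply: idealMr | rewrite -namulBr; apply: idealMr].
Qed.

Lemma lspan_incl S : S `<=` lspan S.
Proof.
by move=> x Sx; exists 1, (fun=> 1), (fun=> x); rewrite big_ord1 scale1r.
Qed.

Lemma lspan0 S : lspan S 0.
Proof.
by exists 0, (fun=> 0), (fun=> 0); rewrite big_ord0; split=> // -[].
Qed.

Lemma lspanZ S c x : lspan S x -> lspan S (c *: x).
Proof.
move=> [n [d [v [Sv ->]]]]; exists n, (fun i => c * d i), v; split=> //.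
by rewrite scaler_sumr; apply: eq_bigr => i _; rewrite scalerA.
Qed.

Lemma lspanD S x y : lspan S x -> lspan S y -> lspan S (x + y).
Proof.
move=> [n [c [v [Sv ->]]]] [m [d [w [Sw ->]]]].
exists (n + m)%N, (fun i => match fintype.split i with inl j => c j | inr j => d j end).
exists (fun i => match fintype.split i with inl j => v j | inr j => w j end); split.
  by move=> i; case: fintype.split.
rewrite big_split_ord /=; congr (_ + _); apply: eq_bigr => i _.
  by rewrite (unsplitK (inl i)).
by rewrite (unsplitK (inr i)).
Qed.

Lemma lspan_min S (P : set A) : P 0 -> (forall x y, P x -> P y -> P (x + y)) ->
  (forall (c : F) x, P x -> P (c *: x)) -> S `<=` P -> lspan S `<=` P.
Proof.
move=> P0 PD PZ SP _ [n [c [v [Sv ->]]]].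
by apply: big_ind => // i _; apply/PZ/SP.
Qed.

Lemma lspan_ideal S : (forall x y, S x -> lspan S (x ** y)) ->
  (forall x y, S y -> lspan S (x ** y)) -> is_ideal (lspan S).
Proof.
move=> Sl Sr; split=> [|x y|c x|x y|x y]; [exact: lspan0|exact: lspanD|exact: lspanZ| |].
- move: x; apply: (lspan_min (P := fun x => lspan S (x ** y))) => [|x z|c x|x].
  + by rewrite namul0l; apply: lspan0.
  + by rewrite namulDl; apply: lspanD.
  + by rewrite namulZl; apply: lspanZ.
  + exact: Sl.
- move: y; apply: (lspan_min (P := fun y => lspan S (x ** y))) => [|y z|c y|y].
  + by rewrite namul0r; apply: lspan0.
  + by rewrite namulDr; apply: lspanD.
  + by rewrite namulZr; apply: lspanZ.
  + exact: Sr.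
Qed.

Lemma lspan_sub_ideal S I : is_ideal I -> S `<=` I -> lspan S `<=` I.
Proof. by move=> [I0 ID IZ _ _]; apply: lspan_min. Qed.

Lemma lspan_eq0 S : S `<=` [set 0] -> lspan S = [set 0].
Proof.
move=> S0; apply/seteqP; split; last by move=> _ ->; apply: lspan0.
exact: lspan_sub_ideal ideal_zero S0.
Qed.

Lemma lie_square_comm I x y : I x -> I y -> lie_square I (x ** y - y ** x).
Proof. by move=> Ix Iy; apply: lspan_incl; exists x => //; exists y. Qed.

Lemma lie_square_sub I : is_ideal I -> lie_square I `<=` I.
Proof.
move=> idI; apply: lspan_sub_ideal => // _ [x Ix [y Iy <-]].
by apply: idealB => //; apply: idealMl.
Qed.

Lemma trivial_idealM I x y : trivial_ideal I -> I x -> I y -> x ** y = 0.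
Proof.
move=> [_ I20] Ix Iy; suff : [set 0] (x ** y) by [].
by rewrite -I20; apply: lspan_incl; exists x => //; exists y.
Qed.

Lemma baer1_ideal : is_ideal (baer1 A).
Proof.
split=> [|x y [n [I [v [Iv ->]]]] [m [K [w [Kw ->]]]]|c x [n [I [v [Iv ->]]]]
        |x y [n [I [v [Iv ->]]]]|x y [n [I [v [Iv ->]]]]].
- by exists 0, (fun=> set0), (fun=> 0); rewrite big_ord0; split=> // -[].
- exists (n + m)%N, (fun i => match fintype.split i with inl j => I j | inr j => K j end).
  exists (fun i => match fintype.split i with inl j => v j | inr j => w j end); split.
    by move=> i; case: fintype.split.
  rewrite big_split_ord /=; congr (_ + _); apply: eq_bigr => i _.
    by rewrite (unsplitK (inl i)).
  by rewrite (unsplitK (inr i)).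
- exists n, I, (fun i => c *: v i); rewrite scaler_sumr; split=> // i.
  by have [tI Ii] := Iv i; split=> //; apply: idealZ => //; apply: tI.1.
- exists n, I, (fun i => v i ** y); split.
    by move=> i; have [tI Ii] := Iv i; split=> //; apply: idealMl => //; apply: tI.1.
  apply: (big_morph (fun x => x ** y)) => [a b|]; [exact: namulDl|exact: namul0l].
- exists n, I, (fun i => x ** v i); split.
    by move=> i; have [tI Ii] := Iv i; split=> //; apply: idealMr => //; apply: tI.1.
  apply: (big_morph (fun y => x ** y)) => [a b|]; [exact: namulDr|exact: namul0r].
Qed.

End Ideals.

(** * One Baer step, described inside [A] modulo [J] *)

Section BaerPreimage.
Context {F : fieldType} {A : naAlgType F}.
Implicit Types (x y z : A) (I J K : set A).

Lemma quot_pi_preim_ideal J (idJ : is_ideal J) (I : set (quot_alg idJ)) :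
  is_ideal I -> is_ideal [set x | I (quot_pi idJ x)].
Proof.
move=> idI; split=> /= [|x y|c x|x y|x y].
- by rewrite (quot_pi_ker idJ 0).2; apply: ideal0.
- by rewrite quot_piD; apply: idealD.
- by rewrite quot_piZ; apply: idealZ.
- by rewrite quot_piM; apply: idealMl.
- by rewrite quot_piM; apply: idealMr.
Qed.

Lemma quot_pi_im_ideal J (idJ : is_ideal J) I :
  is_ideal I -> is_ideal (quot_pi idJ @` I).
Proof.
move=> idI; split=> [|_ _ [x Ix <-] [y Iy <-]|c _ [x Ix <-]|_ u [x Ix <-]|u _ [x Ix <-]].
- by exists 0; [apply: ideal0 | apply/quot_pi_ker/ideal0].
- by rewrite -quot_piD; exists (x + y) => //; apply: idealD.
- by rewrite -quot_piZ; exists (c *: x) => //; apply: idealZ.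
- have [y <-] := quot_pi_surj u; rewrite -quot_piM.
  by exists (x ** y) => //; apply: idealMl.
- have [y <-] := quot_pi_surj u; rewrite -quot_piM.
  by exists (y ** x) => //; apply: idealMr.
Qed.

Lemma baer_preimage_ideal J : is_ideal J -> is_ideal (baer_preimage J).
Proof.
move=> idJ; rewrite (_ : baer_preimage J = [set x | baer1 _ (quot_pi idJ x)]).
  exact: (quot_pi_preim_ideal (I := baer1 _) baer1_ideal).
apply/seteqP; split=> x /=; last by exists idJ.
(* The quotient type depends on the proof that [J] is an ideal; proof irrelevance identifies the two
   quotients. *)
by case=> idJ'; rewrite (Prop_irrelevance idJ' idJ).
Qed.

Lemma sub_baer_preimage J : is_ideal J -> J `<=` baer_preimage J.
Proof.
move=> idJ x Jx; exists idJ; rewrite (quot_pi_ker idJ x).2 //.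
exact: (ideal0 baer1_ideal).
Qed.

(** The image of [I] in [A / J] is a trivial ideal, so each of its elements is a one-term sum in
    [baer1]. *)
Lemma sq_sub_baer_preimage J I : is_ideal J -> is_ideal I ->
  (forall a b, I a -> I b -> J (a ** b)) -> I `<=` baer_preimage J.
Proof.
move=> idJ idI IIJ x Ix; exists idJ.
exists 1, (fun=> quot_pi idJ @` I), (fun=> quot_pi idJ x).
rewrite big_ord1; split=> // _; split; last by exists x.
split; first exact: quot_pi_im_ideal.
apply: lspan_eq0 => _ [_ [a Ia <-] [_ [b Ib <-] <-]].
by rewrite -quot_piM; apply/quot_pi_ker/IIJ.
Qed.

(** Pulling the trivial ideals of [A / J] back to [A] lets the nil argument use the Novikov
    identities in [A]; the quotient never needs a Novikov structure. *)
Lemma baer_preimageP J x : is_ideal J -> baer_preimage J x ->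
  exists (n : nat) (I : 'I_n -> set A) (v : 'I_n -> A),
    [/\ forall i, is_ideal (I i),
        forall i a b, I i a -> I i b -> J (a ** b),
        forall i, I i (v i) & J (x - \sum_(i < n) v i)].
Proof.
move=> idJ [idJ' [n [I [v [Iv xE]]]]].
have [w wE] := choice (fun i => quot_pi_surj (v i)).
exists n, (fun i => [set a | I i (quot_pi idJ' a)]), w; split=> [i|i a b Ia Ib|i|] /=.
- by have [[idI _] _] := Iv i; apply: quot_pi_preim_ideal.
- apply/(quot_pi_ker idJ'); rewrite quot_piM.
  by apply: (@trivial_idealM _ _ (I i)) => //; have [] := Iv i.
- by rewrite wE; have [] := Iv i.
- apply/(quot_pi_eq idJ'); rewrite xE.
  rewrite (big_morph (quot_pi idJ') (quot_piD idJ') ((quot_pi_ker idJ' 0).2 (ideal0 idJ'))).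
  by apply: eq_bigr => i _; rewrite wE.
Qed.

End BaerPreimage.

(** * Identities for commutators, associators and left-normed powers *)

Section NovikovIdentities.
Context {F : fieldType} {A : novikovType F}.
Implicit Types (a b c d x y z : A).

(* The axiom [right_commutative_mul] is stated over the unfolded [NAAlgebra]
   structure of [A], which syntactic rewriting does not identify with the
   canonical one; hence these restatements. *)
Lemma namulAC x y z : (x ** y) ** z = (x ** z) ** y.
Proof. exact: right_commutative_mul. Qed.

Lemma nassocAC x y z : nassoc x y z = nassoc y x z.
Proof. exact: left_symmetric. Qed.

Lemma namul_nassoc x y z : x ** (y ** z) = (x ** y) ** z - nassoc x y z.
Proof. by rewrite /nassoc subKr. Qed.

Lemma nassoc_mull x y z d : nassoc (x ** d) y z = nassoc x y z ** d.
Proof.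
by rewrite /nassoc namulBl (namulAC x d) !(namulAC _ d).
Qed.

Lemma namul_commutator b x y :
  b ** (x ** y - y ** x) = nassoc b y x - nassoc b x y.
Proof. by rewrite /nassoc (namulAC b y) opprB [RHS]addrC addrA subrK namulBr. Qed.

(** By left symmetry the associators (a, b, x) and (b, a, x) cancel. The characteristic enters
    through the factor 2, which must be inverted to recover [a, b] x. *)
Lemma commutator_mulr a b x :
  ((a ** x) ** b - b ** (a ** x)) + (a ** (b ** x) - (b ** x) ** a) =
  (a ** b - b ** a) ** x *+ 2.
Proof.
rewrite !namul_nassoc (nassocAC b) namulBl mulr2n.
rewrite (namulAC a x) (namulAC b x).
move: (nassoc a b x) (a ** b ** x) (b ** a ** x) => N P Q.
rewrite opprB [P - N - Q]addrAC [P + (N - Q)]addrCA [N + _]addrC addrACA.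
by rewrite subrr addr0.
Qed.

Lemma commutator_mull a b x :
  (a ** (x ** b) - (x ** b) ** a) + ((x ** a) ** b - b ** (x ** a)) =
  (a ** b - b ** a) ** x + x ** (a ** b - b ** a).
Proof.
rewrite (namulAC x b) addrA subrK !namul_nassoc namulBl namulBr.
rewrite !namul_nassoc (nassocAC a x) (nassocAC b x).
rewrite (namulAC a x) (namulAC b x) (namulAC x b).
move: (nassoc x a b) (nassoc x b a) (a ** b ** x) (b ** a ** x) (x ** a ** b).
move=> N M P Q X; rewrite !opprB [X - N + _]addrC subrKA.
by rewrite addrACA [RHS]addrACA [- N - Q]addrC.
Qed.

Lemma lpowSr x n : (0 < n)%N -> lpow x n.+1 = lpow x n ** x.
Proof. by case: n. Qed.

(** Left symmetry moves the power into the first argument, from which [nassoc_mull] pulls out its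
    right factors [x] one by one. *)
Lemma nassoc_lpow a x p :
  nassoc a (lpow x p.+1) x = iter p (fun z => z ** x) (nassoc a x x).
Proof.
rewrite nassocAC; elim: p => [|p IHp]; first exact: nassocAC.
by rewrite lpowSr // nassoc_mull IHp.
Qed.

Lemma namul_lpow a x p :
  (a ** lpow x p.+1) ** x - a ** lpow x p.+2 =
  iter p (fun z => z ** x) (nassoc a x x).
Proof. by rewrite [lpow x p.+2]lpowSr // namul_nassoc subKr nassoc_lpow. Qed.

(** Unrolling [namul_lpow] subtracts the same associator term once per step. For p = 0 that term has
    multiplicity 0, so the truncated [p.-1] is harmless. *)
Lemma namul_lpowE a x p :
  a ** lpow x p.+1 = iter p.+1 (fun z => z ** x) a
    - (iter p.-1 (fun z => z ** x) (nassoc a x x)) *+ p.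
Proof.
elim: p => [|p IHp]; first by rewrite subr0.
have /(canRL (subKr _)) -> := namul_lpow a x p.
rewrite IHp namulBl /= mulrSr opprD addrA; congr (_ - _ - _).
case: p {IHp} => [|p] /=; first by rewrite namul0l.
elim: p.+1 => [|n IHn]; first by rewrite namul0l.
by rewrite !mulrSr namulDl IHn.
Qed.

End NovikovIdentities.

(** * Descending from a Baer step to [J] by raising the exponent *)

Section NilModuloIdeal.
Context {F : fieldType} {A : novikovType F}.
Implicit Types (x y z : A) (I J K : set A).

Lemma lpowD x m k : (0 < m)%N ->
  lpow x (m + k) = iter k (fun z => z ** x) (lpow x m).
Proof. by case: m => // m _; rewrite addnC /lpow addnS /= iterD. Qed.

(* [a x^m] and [a x^(m+1)] lie in [K] for all [a] in [I]; eliminating the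
   associator [(a, x, x)] between the two expansions leaves [a R_x^(m+1)]. *)
Lemma lpow_mod_sq I K x m : is_ideal I -> is_ideal K ->
  (forall a b, I a -> I b -> K (a ** b)) -> (0 < m)%N ->
  I (lpow x m) -> K (lpow x (m + m.+1)).
Proof.
case: m => // p idI idK IIK _ Ix; rewrite lpowD //.
(* With a = x^m itself, a R_x^(m+1) is the power x^(2m+1). *)
set a := lpow x p.+1.
have Ix' : I (lpow x p.+2) by rewrite lpowSr //; apply: idealMl.
have Kt : K (iter p (fun z => z ** x) (nassoc a x x)).
  rewrite -namul_lpow; apply: idealB => //; last exact: IIK.
  by apply: idealMl => //; apply: IIK.
have := IIK _ _ Ix Ix'; rewrite namul_lpowE => KB.
rewrite -[X in K X](subrK (iter p (fun z => z ** x) (nassoc a x x) *+ p.+1)).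
by apply: idealD => //; rewrite -scaler_nat; apply: idealZ.
Qed.

(** Induction on the number of summands: the first ideal is absorbed into [K], the sum of [I ord0]
    and [J]. Since products of elements of [K] lie in [J], [lpow_mod_sq] then leads from [K] back to
    [J]. *)
Lemma lpow_mod_sum n (I : 'I_n -> set A) (v : 'I_n -> A) J x m :
  is_ideal J -> (forall i, is_ideal (I i)) ->
  (forall i a b, I i a -> I i b -> J (a ** b)) -> (forall i, I i (v i)) ->
  (0 < m)%N -> J (lpow x m - \sum_(i < n) v i) ->
  exists2 k, (0 < k)%N & J (lpow x k).
Proof.
elim: n I v J m => [|n IHn] I v J m idJ idI IIJ Iv m_gt0.
  by rewrite big_ord0 subr0; exists m.
pose K := ideal_add (I ord0) J.
have idK : is_ideal K by apply: ideal_add_ideal.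
have JK : J `<=` K.
  by move=> z Jz; exists 0; [apply: ideal0 | rewrite subr0].
rewrite big_ord_recl => Jx.
have [] := IHn (fun i => I (lift ord0 i)) (fun i => v (lift ord0 i)) K m => //.
- by move=> i a b Ia Ib; apply/JK/(IIJ _ _ _ Ia Ib).
- by exists (v ord0) => //; rewrite addrAC -addrA -opprD.
move=> k k_gt0 Kx; exists (k + k.+1)%N; first by rewrite addnS.
apply: (lpow_mod_sq idK idJ _ k_gt0 Kx) => a b [a' Ia' Ja] [b' Ib' Jb].
rewrite -[a](subrK a') namulDl; apply: idealD => //; first exact: idealMl.
rewrite -[b](subrK b') namulDr; apply: idealD => //; first exact: idealMr.
exact: IIJ Ia' Ib'.
Qed.

Lemma lpow_baer_preimage J x m : is_ideal J -> (0 < m)%N ->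
  baer_preimage J (lpow x m) -> exists2 k, (0 < k)%N & J (lpow x k).
Proof.
move=> idJ m_gt0 /(baer_preimageP idJ)[n [I [v [idI IIJ Iv Jx]]]].
exact: lpow_mod_sum idJ idI IIJ Iv m_gt0 Jx.
Qed.

End NilModuloIdeal.

(** * Products and commutators of ideals *)

Section LieSolvable.
Context {F : fieldType} {A : novikovType F}.
Implicit Types (x y z : A) (I J K L : set A).

Definition prod_span I : set A := lspan [set a ** b | a in I & b in I].

Lemma prod_spanM I a b : I a -> I b -> prod_span I (a ** b).
Proof. by move=> Ia Ib; apply: lspan_incl; exists a => //; exists b. Qed.

Lemma prod_span_ideal I : is_ideal I -> is_ideal (prod_span I).
Proof.
move=> idI; apply: lspan_ideal => [_ x [a Ia [b Ib <-]]|x _ [a Ia [b Ib <-]]].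
  by rewrite namulAC; apply: prod_spanM => //; apply: idealMl.
(* Left symmetry gives x (a b) = a (x b) + (x a) b - (a x) b. *)
rewrite namul_nassoc nassocAC /nassoc opprB addrCA.
apply: lspanD; first by apply: prod_spanM => //; apply: idealMr.
rewrite -[X in _ - X]scale1r -scaleNr; apply: lspanD; last apply: lspanZ.
  by apply: prod_spanM => //; apply: idealMr.
by apply: prod_spanM => //; apply: idealMl.
Qed.

Lemma prod_span_sub I : is_ideal I -> prod_span I `<=` I.
Proof.
by move=> idI; apply: lspan_sub_ideal => // _ [x Ix [y Iy <-]]; apply: idealMl.
Qed.

Lemma lie_square_ideal I : 2%N \notin [pchar F] ->
  is_ideal I -> is_ideal (lie_square I).
Proof.
move=> charF idI.
have two_neq0 : 2%:R != 0 :> F by move: charF; rewrite inE.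
have brl a b x : I a -> I b -> lie_square I ((a ** b - b ** a) ** x).
  move=> Ia Ib; rewrite -[X in lie_square I X]scale1r -(mulVf two_neq0) -scalerA.
  apply: lspanZ; rewrite scaler_nat -commutator_mulr.
  by apply: lspanD; apply: lie_square_comm => //; apply: idealMl.
apply: lspan_ideal => [_ x [a Ia [b Ib <-]]|x _ [a Ia [b Ib <-]]]; first exact: brl.
have /(canRL (addKr _)) -> := esym (commutator_mull a b x).
rewrite -scaleN1r; apply: lspanD; first exact/lspanZ/brl.
by apply: lspanD; apply: lie_square_comm => //; apply: idealMr.
Qed.

Lemma lie_derived_ideal n : 2%N \notin [pchar F] -> is_ideal (@lie_derived F A n).
Proof.
by move=> charF; elim: n => [|n IHn]; [apply: ideal_full | apply: lie_square_ideal].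
Qed.

(* Since [(b, x, y) c = (x c, b, y)] and products with a factor in [K] stay in
   [K], commutativity of [K] modulo [J] kills [[K, K, A] K], hence [K K K]. *)
Lemma lie_square_cube J L a b c : is_ideal J -> is_ideal L ->
  let K := lie_square L in is_ideal K -> lie_square K `<=` J ->
  K a -> K b -> K c -> J ((a ** b) ** c).
Proof.
move=> idJ idL K idK KKJ Ka Kb Kc.
have commK u v : K u -> K v -> J (u ** v - v ** u).
  by move=> Ku Kv; apply/KKJ/lie_square_comm.
have assocK u v y : K u -> K v -> J (nassoc u v y).
  move=> Ku Kv; rewrite /nassoc.
  apply: (ideal_subl (y := (u ** v - v ** u) ** y)) => //; last first.
    by apply: idealMl => //; apply: commK.
  rewrite namulBl (namulAC v) opprB addrC addrA subrK.
  by apply: commK => //; apply: idealMl.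
have assoc_mul x y : J (nassoc b x y ** c).
  by rewrite nassocAC -nassoc_mull; apply: assocK => //; apply: idealMr.
apply: (ideal_subl (y := (b ** a) ** c)) => //.
  by rewrite -namulBl; apply: idealMl => //; apply: commK.
(* The goal is linear in [a], so [a] may be taken to be a commutator [x, y]; then b [x, y] is a
   difference of associators starting with [b]. *)
move: a Ka; apply: lspan_min => [|x y|d x|_ [x _ [y _ <-]]].
- by rewrite namul0r namul0l; apply: ideal0.
- by rewrite namulDr namulDl; apply: idealD.
- by rewrite namulZr namulZl; apply: idealZ.
rewrite namul_commutator namulBl.
exact: idealB.
Qed.

End LieSolvable.

(** * Baer levels at finite ordinals *)

Definition baer_fin (F : fieldType) (A : naAlgType F) (k : nat) : set A :=
  iter k (@baer_preimage F A) [set 0].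

Arguments baer_fin {F} A k.

Lemma baer_fin_ideal {F : fieldType} (A : naAlgType F) k : is_ideal (baer_fin A k).
Proof. by elim: k => [|k IHk]; [apply: ideal_zero | apply: baer_preimage_ideal]. Qed.

Section FiniteLevels.
Context {F : fieldType} {A : novikovType F}.
Implicit Types (x y z : A) (I J K L : set A).

(** Two steps suffice: K^2 K^2 lies in K^2 K, hence in [J], so K^2 enters at the first step and [K]
    at the second. *)
Lemma lie_square_sub_baer_preimage J L : 2%N \notin [pchar F] ->
  is_ideal J -> is_ideal L -> lie_square (lie_square L) `<=` J ->
  lie_square L `<=` baer_preimage (baer_preimage J).
Proof.
move=> charF idJ idL KKJ; set K := lie_square L.
have idK : is_ideal K by apply: lie_square_ideal.
apply: sq_sub_baer_preimage => //; first exact: baer_preimage_ideal.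
suff KK : prod_span K `<=` baer_preimage J.
  by move=> a b Ka Kb; apply/KK/prod_spanM.
apply: sq_sub_baer_preimage => // [|z w].
  exact: prod_span_ideal.
move=> Kz /(prod_span_sub idK) Kw; move: z Kz.
apply: lspan_min => [|x y|d x|_ [a Ka [b Kb <-]]].
- by rewrite namul0l; apply: ideal0.
- by rewrite namulDl; apply: idealD.
- by rewrite namulZl; apply: idealZ.
exact: (lie_square_cube idJ idL idK KKJ).
Qed.

Lemma lie_derived1_sub_baer_fin : 2%N \notin [pchar F] -> lie_solvable A ->
  exists k, lie_square [set: A] `<=` baer_fin A k.
Proof.
move=> charF [n An0].
(* The descent stops at [A, A], because each ideal it treats must be of the form [L, L]; the shift
   to [n.+1] also covers n = 0. *)
have : @lie_derived F A n.+1 `<=` baer_fin A 0.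
  by rewrite /baer_fin /= -An0; apply: lie_square_sub (lie_derived_ideal _ charF).
elim: n {An0} 0%N => [|n IHn] k AnJ; first by exists k.
apply: (IHn k.+2); apply: lie_square_sub_baer_preimage => //.
  exact: baer_fin_ideal.
exact: lie_derived_ideal.
Qed.

(* Modulo [J] the algebra is commutative and associative, and the ideal
   generated by [x], intersected with the annihilator of [x], squares to zero. *)
Lemma lpow_pred_baer_preimage J x n : is_ideal J ->
  lie_square [set: A] `<=` J -> (0 < n)%N ->
  J (lpow x n.+1) -> baer_preimage J (lpow x n).
Proof.
move=> idJ AJ n_gt0 Jx.
have commJ y z : J (y ** z - z ** y) by apply/AJ/lie_square_comm.
pose T : set A := [set w | J (w ** x) /\
  exists (c : F) z, J (w - (c *: x + z ** x))].
have TD v w : T v -> T w -> T (v + w).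
  move=> [Jv [c [y Jcy]]] [Jw [d [z Jdz]]]; split.
    by rewrite namulDl; apply: idealD.
  exists (c + d), (y + z); rewrite scalerDl namulDl [_ + _ + (_ + _ : A)]addrACA.
  by rewrite opprD addrACA; apply: idealD.
have TJ w : J w -> T w.
  move=> Jw; split; first exact: idealMl.
  by exists 0, 0; rewrite scale0r namul0l addr0 subr0.
have TMl w y : T w -> T (w ** y).
  move=> [Jw [c [z Jcz]]]; split.
    by rewrite namulAC; apply: idealMl.
  exists 0, (c *: y + z ** y); rewrite scale0r add0r namulDl (namulAC z) namulZl.
  rewrite -(subrK ((c *: x + z ** x) ** y) (w ** y)) -namulBl -addrA.
  apply: idealD => //; first exact: idealMl.
  rewrite namulDl namulZl opprD addrACA subrr addr0 -scalerBr.
  exact: idealZ.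
have idT : is_ideal T.
  split=> // [|c w [Jw [d [z Jdz]]]|y w Tw].
  - exact/TJ/ideal0.
  - split; first by rewrite namulZl; apply: idealZ.
    exists (c * d), (c *: z); rewrite -scalerA namulZl -scalerDr -scalerBr.
    exact: idealZ.
  - rewrite -[y ** w](subrK (w ** y)); apply: TD; last exact: TMl.
    exact/TJ/commJ.
apply: (sq_sub_baer_preimage idJ idT) => [a b [Ja _] [_ [c [z Jb]]]|].
  apply: (ideal_subl (y := a ** (c *: x + z ** x))) => //.
    by rewrite -namulBr; apply: idealMr.
  rewrite namulDr namulZr; apply: idealD => //; first exact: idealZ.
  (* Modulo [J], a (z x) = (z x) a = (z a) x = (a z) x = (a x) z, and a x lies in [J]. *)
  apply: (ideal_subl (y := (z ** x) ** a)) => //; rewrite (namulAC z).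
  apply: (ideal_subl (y := (a ** z) ** x)) => //.
    by rewrite -namulBl; apply: idealMl.
  by rewrite namulAC; apply: idealMl.
split; first by rewrite -lpowSr.
case: n n_gt0 {Jx} => [|[|n]] // _.
  by exists 1, 0; rewrite scale1r namul0l addr0 subrr; apply: ideal0.
by exists 0, (lpow x n.+1); rewrite scale0r add0r -lpowSr // subrr; apply: ideal0.
Qed.

Lemma nil_sub_baer_fin x n : 2%N \notin [pchar F] -> lie_solvable A ->
  (0 < n)%N -> lpow x n = 0 -> exists k, baer_fin A k x.
Proof.
move=> charF solA n_gt0 xn0; have [k AJ] := lie_derived1_sub_baer_fin charF solA.
have := ideal0 (baer_fin_ideal A k); rewrite -xn0.
case: n n_gt0 {xn0} => // n _; elim: n k AJ => [|n IHn] k AJ Jx; first by exists k.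
apply: (IHn k.+1) => [z /AJ|].
  exact/sub_baer_preimage/baer_fin_ideal.
by apply: lpow_pred_baer_preimage => //; apply: baer_fin_ideal.
Qed.

End FiniteLevels.

(** * Finite ordinals inside a well-order *)

Lemma inj_in_card_le (T U : Type) (S : set T) (B : set U) (f : T -> U) :
  (forall x y, S x -> S y -> f x = f y -> x = y) ->
  (forall x, S x -> B (f x)) -> S #<= B.
Proof.
move=> injf fSB; have /card_le_eql <- : f @` S #= S.
  by apply: inj_card_eq => x y /set_mem Sx /set_mem Sy; apply: injf.
apply: subset_card_le => _ [x Sx <-].
exact: fSB.
Qed.

Section WellOrder.
Context {W : Type} {R : rel W} (woR : wochoice.well_order R).
Implicit Types (u v w : W).

Lemma wo_min (P : W -> Prop) : (exists u, P u) ->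
  exists2 z, P z & forall u, P u -> R z u.
Proof.
move=> [u Pu]; have [|z [[/asboolP Pz minz] _]] := @woR (fun u => `[< P u >]).
  by exists u; apply/asboolP.
by exists z => // v Pv; apply/minz/asboolP.
Qed.

Lemma wle_total u v : R u v \/ R v u.
Proof.
have [|z zuv minz] := wo_min (P := fun w => w = u \/ w = v); first by exists u; left.
by case: zuv minz => -> minz; [left|right]; apply: minz; [right|left].
Qed.

Lemma wle_antisym u v : R u v -> R v u -> u = v.
Proof.
by move=> uv vu; apply: (well_order_antisymmetric woR); rewrite uv vu.
Qed.

Lemma nwltP u v : ~ wlt R u v -> R v u.
Proof. by move=> nuv; apply: contrapT => /negP. Qed.

Lemma wle_eqVlt u v : R u v -> u = v \/ wlt R u v.
Proof.
move=> uv; have [/(wle_antisym uv)|/negP] := pselect (R v u); first by left.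
by right.
Qed.

Lemma wcases w : [\/ wzero R w, exists v, wsucc R v w | wlimit R w].
Proof.
have [|nz] := pselect (wzero R w); first by constructor 1.
have [|/forallNP ns] := pselect (exists v, wsucc R v w); first by constructor 2.
by constructor 3.
Qed.

Lemma wsucc_exists u w : wlt R u w -> exists2 v, wsucc R u v & R v w.
Proof.
move=> uw; have [|v uv minv] := wo_min (P := wlt R u); first by exists w.
by exists v; [split=> // z /negP nvz /minv|apply: minv].
Qed.

(* [w] represents the finite ordinal [k]. *)
Fixpoint windex (k : nat) w : Prop :=
  if k is j.+1 then exists2 v, wsucc R v w & windex j v else wzero R w.

Lemma windex_inj k u v : windex k u -> windex k v -> u = v.
Proof.
elim: k u v => [|k IHk] u v /=.
  by move=> u0 v0; apply: wle_antisym; apply: nwltP.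
move=> [u' [u'u maxu] ku'] [v' [v'v maxv] kv'].
have E := IHk _ _ ku' kv'; subst v'.
by apply: wle_antisym; apply: nwltP => /[dup]; [move=> /maxu|move=> /maxv].
Qed.

Lemma windex_lt k u w : windex k w -> wlt R u w -> exists2 i, (i < k)%N & windex i u.
Proof.
elim: k w => [|k IHk] w /=; first by move=> w0 /w0.
move=> [v [vw maxv] kv] /maxv/nwltP/wle_eqVlt[->|uv]; first by exists k.
by have [i ik iu] := IHk _ kv uv; exists i => //; apply: ltnW.
Qed.

(** Induction on [k], moving to the successor as long as it does not pass [w]. This compares [delta]
    with a given finite level. *)
Lemma windex_exists k w :
  (exists2 v, R v w & windex k v) \/ (exists2 j, (j < k)%N & windex j w).
Proof.
elim: k => [|k [[v /wle_eqVlt[->|vw] kv]|[j jk jw]]].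
- have [|z _ minz] := wo_min (P := fun=> True); first by exists w.
  by left; exists z; [apply: minz | move=> v; rewrite /wlt minz].
- by right; exists k.
- by have [z vz zw] := wsucc_exists vw; left; exists z => //; exists v.
- by right; exists j => //; apply: ltnW.
Qed.

Lemma windex_card k w : windex k w -> [set u | wlt R u w] #<= `I_k.
Proof.
move=> kw; have /choice[f fP] (u : W) : exists i, wlt R u w -> (i < k)%N /\ windex i u.
  have [uw|nuw] := pselect (wlt R u w); last by exists 0%N.
  by have [i] := windex_lt kw uw; exists i.
apply: (inj_in_card_le (f := f)) => [u v /fP[_ fu] /fP[_ fv] E|u /fP[]//].
by rewrite E in fu; apply: windex_inj fu fv.
Qed.

End WellOrder.

(** * The transfinite chain and its finite levels *)

Section BaerChain.
Context {F : fieldType}.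
Context {W : Type} {R : rel W} (woR : wochoice.well_order R).
Implicit Types (u v w : W).

(** Both claims are proved together: a union at a limit is closed under addition by monotonicity
    below it, and inclusion at a successor needs the previous level to be an ideal. *)
Lemma baer_chain (A : naAlgType F) w : is_ideal (baer A woR w) /\
  forall v, wlt R v w -> baer A woR v `<=` baer A woR w.
Proof.
elim/(well_founded_ind (wlt_wf woR)): w => w IHw.
have mono u v : wlt R v w -> R u v -> baer A woR u `<=` baer A woR v.
  by move=> vw /(wle_eqVlt woR)[-> //|uv]; apply: (IHw v vw).2.
have [w0|[v vw]|lw] := @wcases _ R w.
- by rewrite baer_zero //; split=> [|v /w0//]; apply: ideal_zero.
- rewrite (baer_succ A woR vw); have [vltw maxv] := vw.
  have idv := (IHw v vltw).1.
  split=> [|u uw]; first exact: baer_preimage_ideal.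
  by move=> x /(mono _ _ vltw (nwltP (maxv u uw))); apply: sub_baer_preimage.
- rewrite baer_limit //; split; last by move=> v vw x Bx; exists v.
  split=> [|x y [u uw Bx] [v vw By]|c x [v vw Bx]|x y [v vw Bx]|x y [v vw Bx]].
  + have [nz _] := lw; have /existsNP[v /contrapT vw] := nz.
    by exists v => //; apply: ideal0; apply: (IHw v vw).1.
  + have [uv|vu] := wle_total woR u v.
      exists v => //; apply: idealD => //; first exact: (IHw v vw).1.
      exact: mono Bx.
    exists u => //; apply: idealD => //; first exact: (IHw u uw).1.
    exact: mono By.
  + by exists v => //; apply: idealZ => //; apply: (IHw v vw).1.
  + by exists v => //; apply: idealMl => //; apply: (IHw v vw).1.
  + by exists v => //; apply: idealMr => //; apply: (IHw v vw).1.
Qed.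

Lemma baer_mono (A : naAlgType F) u v : R u v -> baer A woR u `<=` baer A woR v.
Proof.
by move=> /(wle_eqVlt woR)[-> //|]; apply: (baer_chain A v).2.
Qed.

Lemma baer_windex (A : naAlgType F) k w :
  windex (R := R) k w -> baer A woR w = baer_fin A k.
Proof.
elim: k w => [|k IHk] w /=; first exact: baer_zero.
by move=> [v vw kv]; rewrite (baer_succ A woR vw) (IHk v).
Qed.

Lemma baer_fin_mono (A : naAlgType F) i j : (i <= j)%N -> baer_fin A i `<=` baer_fin A j.
Proof.
move=> /subnK <-; elim: (j - i)%N => [|n IHn] x // /IHn.
exact/sub_baer_preimage/baer_fin_ideal.
Qed.

(** If the inclusions from level [m] to [m.+1] were strict for all m <= n, choosing a new element at
    each would give n + 1 distinct elements of [A]. Once two consecutive levels agree, the chain is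
    constant. *)
Lemma baer_fin_stable (A : naAlgType F) n k : ~~ (`I_n.+1 #<= [set: A]) ->
  baer_fin A k `<=` baer_fin A n.
Proof.
move=> An; have [m [mn Cm]] : exists m, (m <= n)%N /\ baer_fin A m.+1 `<=` baer_fin A m.
  apply: contrapT => /forallNP stepC; move/negP: An; apply.
  have /choice[y yP] m : exists y, (m <= n)%N ->
      baer_fin A m.+1 y /\ ~ baer_fin A m y.
    have [mn|nmn] := pselect (m <= n)%N; last by exists 0.
    have /not_andP[//|/existsNP[y /not_implyP[? ?]]] := stepC m.
    by exists y.
  have ylt i j : (i < j)%N -> (j <= n)%N -> y i <> y j.
    move=> ij jn E; have [_] := yP j jn; apply; rewrite -E.
    apply: (baer_fin_mono ij); apply: (yP i _).1.
    exact: leq_trans (ltnW ij) jn.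
  apply: (inj_in_card_le (f := y)) => // i j /= i_n j_n E.
  by case: (ltngtP i j) => // [ij|ji]; [case: (ylt i j)|case: (ylt j i)].
have stable l : baer_fin A (l + m) `<=` baer_fin A m.
  elim: l => [|l IHl]; first by [].
  move=> x; suff -> : baer_fin A (l.+1 + m) = baer_fin A m.+1 by apply: Cm.
  by congr baer_preimage; apply/seteqP; split=> //; apply/baer_fin_mono/leq_addl.
apply: subset_trans (baer_fin_mono mn).
apply: subset_trans (stable k); exact/baer_fin_mono/leq_addr.
Qed.

(* If [delta] is finite, then so is [A], and the chain of ideals has become
   stationary before [delta]; otherwise all the finite levels are below [delta]. *)
Lemma baer_fin_sub (A : naAlgType F) delta k : above_card R A delta ->
  baer_fin A k `<=` baer A woR delta.
Proof.
move=> [v vd Av].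
have [[w wd kw]|[j _ jd]] := windex_exists woR k delta.
  by rewrite -(baer_windex A kw); apply: baer_mono.
have [i ij iv] := windex_lt woR jd vd.
rewrite (baer_windex A jd); apply: subset_trans (baer_fin_mono (ltnW ij)).
(* [A] is equipotent to the segment below [v], which has at most [i] elements, so level [i] is
   already stationary. *)
apply: baer_fin_stable; apply/negP => Ai.
have : `I_i.+1 #<= `I_i.
  apply: (card_le_trans Ai); rewrite (card_le_eql Av).
  exact: windex_card.
by rewrite card_le_II ltnn.
Qed.

(* Quantifying over all powers of [x] is what makes the induction go through:
   a power of [x] being nil does not obviously make [x] nil. *)
Lemma lpow_baer (A : novikovType F) w (x : A) m : (0 < m)%N ->
  baer A woR w (lpow x m) -> exists n, (0 < n)%N /\ lpow x n = 0.
Proof.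
elim/(well_founded_ind (wlt_wf woR)): w m => w IHw m m_gt0.
have [w0|[v vw]|lw] := @wcases _ R w.
- by rewrite baer_zero // => xm0; exists m.
- rewrite (baer_succ A woR vw) => /(lpow_baer_preimage (baer_chain A v).1 m_gt0)[k k_gt0].
  by apply: IHw => //; case: vw.
- by rewrite baer_limit // => -[v vw]; apply: IHw.
Qed.

End BaerChain.

Theorem lemma3p1 (F : fieldType) (A : novikovType F)
    (charF : 2%N \notin [pchar F]) (solA : lie_solvable A)
    (W : Type) (R : rel W) (woR : wochoice.well_order R) (delta : W)
    (hdelta : above_card R A delta) :
  baer A woR delta = [set x : A | exists n : nat, (0 < n)%N /\ lpow x n = 0].
Proof.
(* Here [x] is read as its own first power. *)
apply/seteqP; split=> x /=; first exact: (@lpow_baer _ _ _ woR A delta x 1%N).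
move=> [n [n_gt0 xn0]]; have [k Ckx] := nil_sub_baer_fin charF solA n_gt0 xn0.
exact: baer_fin_sub Ckx.
Qed.
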